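(* Let $(\Omega,\mu)$ be an atomless finite measure space and let $p(\cdot),q(\cdot)$ be exponents on $\Omega$ with $q(\cdot)<p(\cdot)$ $\mu$-a.e. and $q^+<\infty$. Let $i:L^{p(\cdot)}(\mu)\hookrightarrow L^{q(\cdot)}(\mu)$ be the inclusion. The following are equivalent: (1) $\int_0^{\mu(\Omega)} a^{\left(\frac{p}{p-q}\right)^*(x)}\,dx<\infty$ for every $a>1$. (2) $i$ is $L$-weakly compact. (3) $i$ is $M$-weakly compact. (4) $i$ is disjointly strictly singular. (5) The restriction of $i$ to any closed subspace spanned by a disjoint sequence of the form $\left(\frac{\chi_{E_n}}{\mu(E_n)^{1/p(t)}}\right)_n$ is not an isomorphism. (6) $\lim_{x\to\mu(\Omega)^-}(\mu(\Omega)-x)^{\left(\frac{p-q}{p}\right)^*(x)}=0$.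
   Context: An exponent on $\Omega$ is a real measurable function $p$ with $1\le p(t)<\infty$ (possibly unbounded); $q^+$ denotes the essential supremum of $q(\cdot)$ on $\Omega$. The variable Lebesgue space $L^{p(\cdot)}(\mu)$ is the space of all (classes of) real measurable $f$ on $\Omega$ such that $\rho_{p(\cdot)}(f/r)<\infty$ for some $r>0$, where $\rho_{p(\cdot)}(f)=\int_\Omega |f(t)|^{p(t)}d\mu$, with the Luxemburg norm $\|f\|_{p(\cdot)}=\inf\{r>0:\rho_{p(\cdot)}(f/r)\le 1\}$. On a finite measure space, $q(\cdot)\le p(\cdot)$ a.e. implies that $L^{p(\cdot)}(\mu)\subset L^{q(\cdot)}(\mu)$ with continuous inclusion. For measurable $f$ on $\Omega$, the distribution function is $\mu_f(s)=\mu(\{t\in\Omega:|f(t)|>s\})$ and the decreasing rearrangement is $f^*(x)=\inf\{s\in[0,\infty):\mu_f(s)\le x\}$ for $x\in[0,\mu(\Omega))$. ''Isomorphism'' means isomorphism onto the image (bounded below). An operator $T:E\to F$ from a Banach lattice $E$ to a Banach space $F$ is disjointly strictly singular (DSS) if there is no normalized pairwise disjoint sequence $(f_n)$ in $E$ such that the restriction of $T$ to the closed linear span $[f_n]$ is an isomorphism. $T$ is $M$-weakly compact if $\lim_n\|Tf_n\|_F=0$ for every norm bounded disjoint sequence $(f_n)$ in $E$. If $E,F$ are Banach function lattices on $(\Omega,\mu)$, $T$ is $L$-weakly compact if $\lim_{n\to\infty}\sup_{f\in B_E}\|(Tf)\chi_{A_n}\|_F=0$ for every sequence $(A_n)$ of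 measurable sets with $\chi_{A_n}\to 0$ $\mu$-a.e., where $B_E$ is the unit ball of $E$. In (5), $(E_n)$ is an (infinite) sequence of pairwise disjoint measurable sets of positive measure, and $\frac{\chi_{E_n}}{\mu(E_n)^{1/p(t)}}$ denotes the function $t\mapsto \chi_{E_n}(t)\,\mu(E_n)^{-1/p(t)}$. *)

(* Defs.v *)
From mathcomp Require Import all_boot all_order all_algebra.
From mathcomp Require Import all_classical all_reals all_analysis ess_sup_inf.

Set Implicit Arguments.
Unset Strict Implicit.
Unset Printing Implicit Defensive.
Import Order.TTheory GRing.Theory Num.Theory.
Import numFieldNormedType.Exports.
Local Open Scope classical_set_scope.
Local Open Scope ring_scope.
Local Open Scope ereal_scope.

Section measure_space.
Context {d : measure_display} {T : measurableType d} {R : realType}.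
Variable mu : {finite_measure set T -> \bar R}.
Implicit Types (p f g : T -> R) (fs : (T -> R)^nat).

Definition atomless :=
  forall A, measurable A -> 0 < mu A ->
    exists B, [/\ measurable B, B `<=` A, 0 < mu B & mu B < mu A].

Definition exponent p := measurable_fun setT p /\ forall t, (1 <= p t)%R.

Definition modular p f : \bar R := \int[mu]_t (`|f t| `^ p t)%:E.

(** A space of classes of functions is described on representatives: its
    members form a set of functions, its norm is a functional that does not
    distinguish a.e. equal functions, and an operator between two such spaces
    is a map on representatives. *)
Record fun_space := FunSpace {
  fs_mem :> (T -> R) -> Prop ;
  fs_norm : (T -> R) -> \bar R }.

(** For measurable f the Luxemburg norm is a real number if f is a member of
    the space and +oo otherwise. *)
Definition Lvar p : fun_space := {|
  fs_mem := [set f : T -> R | measurable_fun setT f /\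
    exists2 r : R, (0 < r)%R & modular p (fun t => f t / r)%R < +oo] ;
  fs_norm := fun f : T -> R => ereal_inf [set r%:E | r in
    [set r : R | (0 < r)%R /\ modular p (fun t => f t / r)%R <= 1]] |}.

Definition unit_ball (E : fun_space) : set (T -> R) :=
  [set f | E f /\ fs_norm E f <= 1].

(** Disjointness in the lattice: |f_m| /\ |f_n| = 0 as classes. *)
Definition disjoint_seq fs :=
  forall m n, m != n ->
    {ae mu, forall t, Num.min `|fs m t|%R `|fs n t|%R = 0%R}.

Definition closed_span (E : fun_space) fs : set (T -> R) :=
  [set g | E g /\ forall e : R, (0 < e)%R -> exists n (a : nat -> R),
    fs_norm E (fun t => g t - \sum_(k < n) a k * fs k t)%R < e%:E].

Section operators.
Variables (E F : fun_space) (op : (T -> R) -> (T -> R)).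

Definition iso_on (V : set (T -> R)) :=
  exists2 c : R, (0 < c)%R &
    forall g, V g -> c%:E * fs_norm E g <= fs_norm F (op g).

Definition L_weakly_compact :=
  forall A : (set T)^nat, (forall n, measurable (A n)) ->
    {ae mu, forall t, (\1_(A n) t : R) @[n --> \oo] --> (0 : R)%R} ->
    ereal_sup [set fs_norm F (fun t => op f t * \1_(A n) t)%R
              | f in unit_ball E] @[n --> \oo] --> 0.

Definition M_weakly_compact :=
  forall fs, (forall n, E (fs n)) ->
    (exists C : R, forall n, fs_norm E (fs n) <= C%:E) ->
    disjoint_seq fs ->
    fs_norm F (op (fs n)) @[n --> \oo] --> 0.

Definition disjointly_strictly_singular :=
  ~ exists fs, [/\ forall n, E (fs n), forall n, fs_norm E (fs n) = 1,
                   disjoint_seq fs & iso_on (closed_span E fs)].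

End operators.

Definition distribution f (s : R) : \bar R := mu [set t | (s < `|f t|)%R].

(** On [0, mu T) the infimum is over a nonempty set, except possibly at x = 0
    when f is essentially unbounded (where [inf] returns 0 instead of +oo). *)
Definition rearrangement f (x : R) : R :=
  inf [set s : R | (0 <= s)%R /\ distribution f s <= x%:E].

Definition normalized_indic p (A : set T) : T -> R :=
  fun t => (\1_A t / (fine (mu A) `^ (p t)^-1))%R.

End measure_space.

(* Main.v *)
Require Import Defs.
From mathcomp Require Import all_boot all_order all_algebra.
From mathcomp Require Import all_classical all_reals all_analysis ess_sup_inf.
From mathcomp Require Import measurable_realfun ring lra.

(** Put r = p / (p - q), so that 1 / r = (p - q) / p. All six conditions
    are equivalent to one statement about the size of the level sets of r,
    [superexp_tail]: mu {r >= S} decays faster than every exponential a ^ (-S).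

    Conditions (1) and (6) are that statement read through rearrangements.
    For (1), mu {r >= S} plays the role of the inverse function of r^*: the
    integral of a ^ r^* over an interval of length mu {r >= S}, where
    r^* >= S, gives a Chebyshev bound ([rearrangement_superexp_tail]), and
    conversely a function whose tails beat (2 a) ^ (-n) has a ^ F integrable,
    by summing over the layers n <= F < n + 1 ([integral_powR_lty], used in
    [superexp_tail_rearrangement]). For (6), put y = mu(T) - x: if
    {1/r <= 1/S} has measure at least y, then (1/r)^*(x) <= 1/S, so that
    y ^ (1/r)^*(x) <= 1/a forces y <= a ^ (-S), and the converse is similar
    ([limit_superexp_tail], [superexp_tail_limit]).

    The operator side is a chain of implications. The inequality
    u ^ q <= u ^ p / b + b ^ r ([powR_le_add]) bounds the q-modular of
    f on a set by a small multiple of its p-modular plus the integral of b ^ r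
    over that set; fast tails make b ^ r integrable for every b, and dominated
    convergence gives L-weak compactness
    ([L_weakly_compact_of_superexp_tail]). A disjoint bounded sequence is
    carried by sets whose indicators tend to 0, so L-weak compactness gives
    M-weak compactness, which leaves no normalized disjoint sequence on which
    the inclusion is bounded below; normalized indicators are such sequences.

    The chain closes by contraposition ([superexp_tail_of_not_iso]). If r has
    a heavy tail, a lacunary choice of levels S_n produces disjoint sets A_n
    on which r >= S_n although mu(A_n) >= a ^ (-S_n) ([disjoint_level_sets]).
    There mu(A_n) ^ (1/r) >= 1/a, and this quantity is precisely the ratio
    between the q-modular and the p-modular of the normalized indicator of
    A_n, so both norms are equivalent on the closed span
    ([iso_on_span_indic]). *)

Set Implicit Arguments.
Unset Strict Implicit.
Unset Printing Implicit Defensive.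
Import Order.TTheory GRing.Theory Num.Theory.
Import numFieldNormedType.Exports.
Local Open Scope classical_set_scope.
Local Open Scope ring_scope.
Local Open Scope ereal_scope.

(** * A pointwise inequality and measurability of powers *)

Section pointwise.
Context {R : realType}.
Local Open Scope ring_scope.
Implicit Types (a b u x y p q : R).

(** The first term on the right dominates when u ^ (p - q) >= b; otherwise
    u < b ^ (1 / (p - q)), so u ^ q <= b ^ (q / (p - q)), and q < p. *)
Lemma powR_le_add u b p q : 0 <= u -> 1 <= b -> 1 <= q -> q < p ->
  u `^ q <= b^-1 * u `^ p + b `^ (p / (p - q)).
Proof.
move=> u0 b1 q1 qp.
have b0 : 0 < b by lra.
have [bu|ub] := leP b (u `^ (p - q)).
- apply: ler_wpDr; first exact: powR_ge0.
  rewrite ler_pdivlMl// (_ : u `^ p = u `^ (p - q) * u `^ q).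
    by rewrite ler_wpM2r// powR_ge0.
  by rewrite -powRD ?subrK//; apply/implyP => /eqP; lra.
- apply: ler_wpDl; first by rewrite mulr_ge0// ?powR_ge0// invr_ge0 ltW.
  rewrite (_ : u `^ q = (u `^ (p - q)) `^ (q / (p - q))).
    apply: (@le_trans _ _ (b `^ (q / (p - q)))).
      by rewrite ge0_ler_powR ?nnegrE ?powR_ge0 ?divr_ge0//; lra.
    apply: ler_powR => //; rewrite ler_pM2r ?invr_gt0; lra.
  by rewrite -powRrM mulrC divfK//; apply/eqP; lra.
Qed.

(** Inversion is discontinuous at 0; writing 1 / x as x * |x| ^ (-2), which also
    holds at 0 where both sides vanish, reduces the claim to powers. *)
Lemma measurable_inv : measurable_fun [set: R] (@GRing.inv R).
Proof.
rewrite (_ : @GRing.inv R = fun x => x * `|x| `^ (-2)).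
  apply: measurable_funM => //.
  by apply: (measurableT_comp (measurable_powR _)); exact: normr_measurable.
apply/funext => x; have [->|x0] := eqVneq x 0; first by rewrite mul0r invr0.
rewrite powRN powR_mulrn// real_normK ?num_real// expr2.
by rewrite invfM mulrA mulfV// mul1r.
Qed.

End pointwise.

Section measurability.
Context {d} {T : measurableType d} {R : realType}.
Local Open Scope ring_scope.
Implicit Types f g : T -> R.

Lemma measurable_funV f : measurable_fun setT f ->
  measurable_fun setT (fun t => (f t)^-1).
Proof. exact: measurableT_comp measurable_inv. Qed.

(** Variable exponents put both arguments of the power on the move, so the
    defining formula exp (g ln f) is used off the zeros of f. *)
Lemma measurable_fun_powR f g :
  measurable_fun setT f -> measurable_fun setT g ->
  measurable_fun setT (fun t => f t `^ g t).
Proof.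
move=> mf mg; rewrite /powR; apply: measurable_fun_ifT.
- exact: measurable_fun_eqr.
- rewrite (_ : (fun _ => _) = \1_(g @^-1` [set 0])); last first.
    apply/funext => t; rewrite indicE; congr (_%:R).
    case: (eqVneq (g t) 0) => [g0|/eqP g0]; first by rewrite mem_set.
    by rewrite memNset.
  by apply: measurable_indic; rewrite -[X in measurable X]setTI; exact: mg.
- apply: (measurableT_comp (@measurable_expR R)).
  apply: measurable_funM => //.
  exact: measurableT_comp (@measurable_ln R) mf.
Qed.

End measurability.

(** * Modulars and Luxemburg norms *)

Section lvar.
Context {d : measure_display} {T : measurableType d} {R : realType}.
Variable mu : {finite_measure set T -> \bar R}.
Implicit Types (p q f g : T -> R) (r : R).

Lemma measurable_modular_fun p f : measurable_fun setT p ->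
  measurable_fun setT f ->
  measurable_fun setT (fun t => (`|f t| `^ p t)%:E).
Proof.
move=> mp mf; apply/measurable_EFinP; apply: measurable_fun_powR => //.
exact: measurableT_comp.
Qed.

Lemma ae_le_modular p q f g : measurable_fun setT p -> measurable_fun setT q ->
  measurable_fun setT f -> measurable_fun setT g ->
  {ae mu, forall t, (`|f t| `^ p t <= `|g t| `^ q t)%R} ->
  modular mu p f <= modular mu q g.
Proof.
move=> mp mq mf mg fg; rewrite /modular; apply: ae_ge0_le_integral => //.
- exact: measurable_modular_fun.
- exact: measurable_modular_fun.
- by apply: filterS fg => t fgt _; rewrite lee_fin.
Qed.

Lemma le_modular p f g : exponent p ->
  measurable_fun setT f -> measurable_fun setT g ->
  (forall t, (`|f t| <= `|g t|)%R) -> modular mu p f <= modular mu p g.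
Proof.
move=> [mp p1] mf mg fg; apply: ae_le_modular => //; apply: aeW => t.
by rewrite ge0_ler_powR ?nnegrE// (le_trans _ (p1 t)).
Qed.

Lemma modular_ge0 p f : 0 <= modular mu p f.
Proof. by apply: integral_ge0 => t _; rewrite lee_fin powR_ge0. Qed.

Lemma Lvar_norm_ge0 p f : 0 <= fs_norm (Lvar mu p) f.
Proof. by apply/ereal_infP => _ [r [r0 _] <-]; rewrite lee_fin ltW. Qed.

Lemma Lvar_norm_le p f r : (0 < r)%R ->
  modular mu p (fun t => f t / r)%R <= 1 -> fs_norm (Lvar mu p) f <= r%:E.
Proof. by move=> r0 fr; apply: ereal_inf_lbound; exists r. Qed.

(** Together with [Lvar_norm_le] this translates between norm and modular. The
    strict inequality spares the attainment of the infimum: the modular is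
    only compared at a smaller radius. *)
Lemma modular_le1 p f r : exponent p -> measurable_fun setT f ->
  fs_norm (Lvar mu p) f < r%:E -> modular mu p (fun t => f t / r)%R <= 1.
Proof.
move=> pe mf /ereal_inf_lt[_ [s [s0 fs] <-]]; rewrite lte_fin => sr.
apply: le_trans fs; have r0 := lt_trans s0 sr.
apply: le_modular => //; [exact: measurable_funM|exact: measurable_funM|].
move=> t; rewrite !normrM ler_wpM2l// !normfV.
by rewrite !gtr0_norm// lef_pV2 ?posrE// ltW.
Qed.

Lemma Lvar_memE p f : exponent p -> measurable_fun setT f ->
  fs_norm (Lvar mu p) f < +oo -> Lvar mu p f.
Proof.
move=> pe mf /ereal_inf_lt[_ [s [s0 fs] <-]] _; split => //.
by exists s => //; rewrite (le_lt_trans fs) ?ltry.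
Qed.

End lvar.

(** * Integrability of powers from exponential tails *)

Section layers.
Context {d} {T : measurableType d} {R : realType}.
Variable nu : {measure set T -> \bar R}.

(** On the layer n <= F < n + 1 the integrand is at most a ^ (n + 1), so the
    n-th layer contributes at most a C / 2 ^ n. *)
Lemma integral_powR_lty (D : set T) (F : T -> R) (a C : R) :
  measurable D -> measurable_fun D F -> (forall x, D x -> (0 <= F x)%R) ->
  (1 < a)%R -> (0 < C)%R ->
  (forall n : nat, nu (D `&` [set x | (n%:R <= F x)%R]) <=
                   (C * (2 * a) ^- n)%R%:E) ->
  \int[nu]_(x in D) (a `^ F x)%:E < +oo.
Proof.
move=> mD mF F0 a1 C0 nuF.
have a0 : (0 < a)%R by lra.
pose E (n : nat) := D `&` [set x | (n%:R <= F x)%R].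
have mE n : measurable (E n) by exact: measurable_fun_le.
pose h n x := (a ^+ n.+1)%:E * (\1_(E n) x)%:E : \bar R.
have h0 n x : 0 <= h n x.
  by rewrite /h -EFinM lee_fin mulr_ge0// exprn_ge0// ltW.
have mh n : measurable_fun D (h n).
  rewrite /h; under [X in measurable_fun _ X]eq_fun do rewrite -EFinM.
  apply/measurable_EFinP; apply: measurable_funM => //.
apply: (@le_lt_trans _ _ (\int[nu]_(x in D) \sum_(n <oo) h n x)).
  apply: ge0_le_integral => //.
  - by move=> x _; rewrite lee_fin powR_ge0.
  - apply/measurable_EFinP.
    exact: measurableT_comp (@measurable_powRr R a) mF.
  - exact: ge0_emeasurable_sum.
  move=> x Dx; pose n := Num.trunc (F x).
  have /andP[nF Fn] := truncn_itv (F0 x Dx).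
  apply: (@le_trans _ _ (h n x)).
    rewrite /h indicE mem_set// mule1 lee_fin -powR_mulrn; last exact: ltW.
    by apply: ler_powR; rewrite ltW.
  apply: le_trans (nneseries_lim_ge n.+1 _) => //.
  by rewrite big_nat_recr//= leeDr// sume_ge0.
rewrite integral_nneseries//.
apply: (@le_lt_trans _ _ (\sum_(n <oo) (2 * a * C / (2 ^ n.+1)%:R)%:E)).
  apply: lee_nneseries => n _; first by rewrite integral_ge0.
  rewrite ge0_integralZl//; last first.
  - by rewrite lee_fin exprn_ge0// ltW.
  - by apply/measurable_EFinP; exact: measurable_indic.
  rewrite integral_indic// /E setIAC setIid.
  apply: (@le_trans _ _ ((a ^+ n.+1)%:E * (C * (2 * a) ^- n)%:E)).
    by apply: lee_pmul => //; rewrite lee_fin exprn_ge0// ltW.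
  rewrite -EFinM lee_fin natrX exprMn !exprS le_eqVlt; apply/orP; left.
  apply/eqP; field.
  by rewrite !expf_neq0// gt_eqF.
apply: le_lt_trans (epsilon_trick0 xpredT _) (ltry _).
by rewrite !mulr_ge0// ltW.
Qed.

End layers.

(** * Tails and decreasing rearrangements *)

Section rearrangement.
Context {d : measure_display} {T : measurableType d} {R : realType}.
Variable mu : {finite_measure set T -> \bar R}.
Implicit Types (f g : T -> R) (s S x y : R).

Let M : R := fine (mu setT).

Lemma fin_measure A : measurable A -> mu A = (fine (mu A))%:E.
Proof. by move=> mA; rewrite fineK// fin_num_measure. Qed.

Lemma fine_measure_le A : measurable A -> (fine (mu A) <= M)%R.
Proof.
move=> mA; rewrite -lee_fin /M -!fin_measure//.
by apply: le_measure; rewrite ?inE//; exact: subsetT.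
Qed.

(** The large inequality S <= |f|, unlike the strict one of the distribution
    function, makes the tail of 1 / g the measure of a sublevel set of g and
    turns tail bounds into lower bounds for rearrangements
    ([le_rearrangement]). *)
Definition tail f S : R := fine (mu [set t | (S <= `|f t|)%R]).

Lemma measurable_tail f S : measurable_fun setT f ->
  measurable [set t | (S <= `|f t|)%R].
Proof.
move=> mf; rewrite -[X in measurable X]setTI.
by apply: measurable_fun_le => //; exact: measurableT_comp.
Qed.

Lemma tailE f S : measurable_fun setT f ->
  mu [set t | (S <= `|f t|)%R] = (tail f S)%:E.
Proof. by move=> mf; rewrite fin_measure//; exact: measurable_tail. Qed.

Lemma tail_ge0 f S : (0 <= tail f S)%R.
Proof. exact: fine_ge0. Qed.

Lemma measurable_distribution_set f s : measurable_fun setT f ->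
  measurable [set t | (s < `|f t|)%R].
Proof.
move=> mf; rewrite (_ : mkset _ = ~` [set t | (`|f t| <= s)%R]).
  apply: measurableC; rewrite -[X in measurable X]setTI.
  by apply: measurable_fun_le => //; exact: measurableT_comp.
by apply/seteqP; split => t /=; rewrite ltNge => /negP.
Qed.

Lemma le_tail f S S' : measurable_fun setT f -> (S <= S')%R ->
  (tail f S' <= tail f S)%R.
Proof.
move=> mf SS'; rewrite -lee_fin -!tailE//.
apply: le_measure; rewrite ?inE; [exact: measurable_tail..|].
by move=> t /=; exact: le_trans.
Qed.

Lemma distribution_le_tail f s : measurable_fun setT f ->
  Defs.distribution mu f s <= (tail f s)%:E.
Proof.
move=> mf; rewrite -tailE//; apply: le_measure; rewrite ?inE.
- exact: measurable_distribution_set.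
- exact: measurable_tail.
- by move=> t /= /ltW.
Qed.

Lemma tail_le_distribution f s S : measurable_fun setT f -> (s < S)%R ->
  (tail f S)%:E <= Defs.distribution mu f s.
Proof.
move=> mf sS; rewrite -tailE//; apply: le_measure; rewrite ?inE.
- exact: measurable_tail.
- exact: measurable_distribution_set.
- by move=> t /=; exact: lt_le_trans.
Qed.

(** The sets {n <= |f|} decrease to the empty set because f is finite
    everywhere. *)
Lemma tail_small f e : measurable_fun setT f -> (0 < e)%R ->
  exists2 S, (1 <= S)%R & (tail f S < e)%R.
Proof.
move=> mf e0.
pose H (n : nat) := [set t | (n.+1%:R <= `|f t|)%R].
have mH n : measurable (H n) by exact: measurable_tail.
have H0 : \bigcap_n H n = set0.
  apply/seteqP; split => // t /(_ (Num.trunc `|f t|) I) /=.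
  by rewrite /H /= leNgt truncnS_gt.
have := @nonincreasing_cvg_mu _ _ _ mu H.
rewrite H0 measure0; move=> /(_ _ mH measurable0) muH.
have /fine_cvgP[_ /cvgrPdist_lt/(_ _ e0)[N _ /(_ N (leqnn N))/=]] :
    (mu \o H) n @[n --> \oo] --> 0.
  apply: muH; first by rewrite ltey_eq; apply/orP; left; exact: fin_num_measure.
  move=> m n mn; apply/subsetPset => t /=; apply: le_trans.
  by rewrite ler_nat ltnS.
rewrite sub0r normrN ger0_norm ?fine_ge0// => He.
by exists N.+1%:R => //; rewrite ler1n.
Qed.

Lemma rearrangement_ge0 f x : (0 <= rearrangement mu f x)%R.
Proof.
rewrite /rearrangement; set A := mkset _.
have [->|/set0P A0] := eqVneq A set0; first by rewrite inf0.
by apply: lb_le_inf => // s [].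
Qed.

Lemma rearrangement_le f s x : (0 <= s)%R -> Defs.distribution mu f s <= x%:E ->
  (rearrangement mu f x <= s)%R.
Proof. by move=> s0 fs; apply: ge_inf => //; exists 0%R => y []. Qed.

(** At x = 0 the set is empty for an essentially unbounded f; this is why the
    lemmas below that need one of its elements require 0 < x. *)
Lemma rearrangement_nonempty f x : measurable_fun setT f -> (0 < x)%R ->
  [set s : R | (0 <= s)%R /\ Defs.distribution mu f s <= x%:E] !=set0.
Proof.
move=> mf /(tail_small mf)[S S1 Sx]; exists S; split.
  exact: le_trans S1.
by apply: le_trans (distribution_le_tail _ mf) _; rewrite lee_fin ltW.
Qed.

Lemma rearrangement_lt f s x : measurable_fun setT f -> (0 < x)%R ->
  (rearrangement mu f x < s)%R ->
  exists s', [/\ (0 <= s')%R, (s' < s)%R & Defs.distribution mu f s' <= x%:E].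
Proof.
move=> mf x0 fs.
have [s' [s'0 fs'] s's] := inf_lt (rearrangement_nonempty mf x0) fs.
by exists s'.
Qed.

Lemma le_rearrangement f s x : measurable_fun setT f -> (0 < x)%R ->
  (x < tail f s)%R -> (s <= rearrangement mu f x)%R.
Proof.
move=> mf x0 xs; apply: lb_le_inf; first exact: rearrangement_nonempty.
move=> s' [_ fs']; rewrite leNgt; apply/negP => s's.
have := le_trans (tail_le_distribution mf s's) fs'.
by rewrite lee_fin leNgt xs.
Qed.

Lemma rearrangement_nonincreasing f x y : measurable_fun setT f -> (0 < x)%R ->
  (x <= y)%R -> (rearrangement mu f y <= rearrangement mu f x)%R.
Proof.
move=> mf x0 xy; apply: lb_le_inf; first exact: rearrangement_nonempty.
move=> s [s0 fs]; apply: rearrangement_le => //.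
by rewrite (le_trans fs)// lee_fin.
Qed.

(** The rearrangement is monotone only for x > 0, its value at x <= 0 being a
    default. Composing with exp (- _) and extending by 0 gives a function that
    is monotone on the whole line. *)
Lemma measurable_rearrangement f : measurable_fun setT f ->
  measurable_fun `]0%R, M[%classic (rearrangement mu f).
Proof.
move=> mf.
pose G x : R := if (0 < x)%R then expR (- rearrangement mu f x) else 0%R.
have mG : measurable_fun setT G.
  apply: nondecreasing_measurable => // x y xy; rewrite /G.
  have [x0|x0] := ltP 0%R x; last by case: ifP => // _; rewrite expR_ge0.
  rewrite (lt_le_trans x0 xy) ler_expR lerN2.
  exact: rearrangement_nonincreasing.
apply: (@eq_measurable_fun _ _ _ _ _ (fun x => - ln (G x))%R).
  move=> x; rewrite inE /= in_itv/= => /andP[x0 _].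
  by rewrite /G x0 expRK opprK.
apply: (measurable_funS measurableT) => //.
apply: measurable_funN; exact: measurableT_comp (@measurable_ln R) mG.
Qed.

(** The condition to which every clause of the theorem is reduced, applied to
    f = p / (p - q). *)
Definition superexp_tail f := forall a : R, (1 < a)%R -> exists2 C, (0 < C)%R &
  forall S, (0 <= S)%R -> (tail f S <= C * a `^ (- S))%R.

Lemma superexp_tail_integrable f : measurable_fun setT f -> superexp_tail f ->
  forall a, (1 < a)%R -> \int[mu]_t (a `^ `|f t|)%:E < +oo.
Proof.
move=> mf fB a a1; have a0 : (0 < a)%R by lra.
have [|C C0 fC] := fB (2 * a)%R; first by lra.
apply: (@integral_powR_lty _ _ _ mu _ _ a C) => //.
  exact: measurableT_comp.
move=> n; rewrite setTI; apply: (@le_trans _ _ (tail f n%:R)%:E).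
  by rewrite -tailE.
rewrite lee_fin (le_trans (fC _ _))// powRN.
by rewrite powR_mulrn//; lra.
Qed.

(** The points x with n + 1 <= f^*(x) lie in ]0, tail f n], so f^* inherits the
    decay of the tails of f with a shift of one layer, which costs a
    factor 2 a. *)
Lemma superexp_tail_rearrangement f : measurable_fun setT f ->
  superexp_tail f -> forall a, (1 < a)%R ->
  \int[lebesgue_measure]_(x in `]0%R, M[%classic)
    (a `^ rearrangement mu f x)%:E < +oo.
Proof.
move=> mf fB a a1; have a0 : (0 < a)%R by lra.
have [|C C0 fC] := fB (2 * a)%R; first by lra.
have M0 : (0 <= M)%R by exact: fine_ge0.
apply: (@integral_powR_lty _ _ _ lebesgue_measure _ _ a
  (M + 2 * a * C)%R) => //.
- exact: measurable_rearrangement.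
- by move=> x _; exact: rearrangement_ge0.
- by rewrite ltr_wpDl// !mulr_gt0.
have mD (n : nat) : measurable
    (`]0%R, M[%classic `&` [set x | (n%:R <= rearrangement mu f x)%R]).
  by apply: measurable_fun_le => //; exact: measurable_rearrangement.
move=> [|n].
  apply: (@le_trans _ _ (lebesgue_measure `]0%R, M[%classic)).
    by apply: le_measure; rewrite ?inE//; exact: mD.
  rewrite lebesgue_measure_itv/= expr0 invr1 mulr1.
  case: ifPn => _; last by rewrite lee_fin addr_ge0// !mulr_ge0// ltW.
  by rewrite -EFinD lee_fin subr0 lerDl !mulr_ge0// ltW.
apply: (@le_trans _ _ (lebesgue_measure `]0%R, tail f n%:R]%classic)).
  apply: le_measure; rewrite ?inE//; first exact: mD.
  move=> x [/=]; rewrite !in_itv/=.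
  move=> /andP[x0 xM] nx; rewrite x0/= leNgt; apply/negP => fx.
  suff : (rearrangement mu f x <= n%:R)%R.
    by move=> /(le_trans nx); rewrite ler_nat ltnn.
  apply: rearrangement_le => //.
  by apply: le_trans (distribution_le_tail _ mf) _; rewrite lee_fin ltW.
apply: (@le_trans _ _ (tail f n%:R)%:E).
  rewrite lebesgue_measure_itv/=; case: ifPn => _; last first.
    by rewrite lee_fin tail_ge0.
  by rewrite -EFinD lee_fin subr0.
rewrite lee_fin (le_trans (fC _ _))// powRN powR_mulrn; last by lra.
rewrite (mulrDl M) (_ : 2 * a * C / _ = C * (2 * a) ^- n)%R.
  by rewrite lerDr mulr_ge0// invr_ge0 exprn_ge0//; lra.
by rewrite exprS invfM; field; rewrite !expf_neq0 ?gt_eqF// mulr_gt0.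
Qed.

(** Chebyshev's inequality: f^* >= S on ]0, tail f S[, so the integral is at
    least tail f S * a ^ S. *)
Lemma rearrangement_superexp_tail f : measurable_fun setT f ->
  (forall a, (1 < a)%R -> \int[lebesgue_measure]_(x in `]0%R, M[%classic)
    (a `^ rearrangement mu f x)%:E < +oo) ->
  superexp_tail f.
Proof.
move=> mf fI a a1; have a0 : (0 < a)%R by lra.
set K := \int[lebesgue_measure]_(x in `]0%R, M[%classic)
    (a `^ rearrangement mu f x)%:E.
have K0 : 0 <= K by apply: integral_ge0 => x _; rewrite lee_fin powR_ge0.
have KE : K = (fine K)%:E by rewrite fineK// ge0_fin_numE// fI.
exists (fine K + 1)%R => [|S S0]; first by rewrite ltr_wpDl// fine_ge0.
rewrite powRN ler_pdivlMr ?powR_gt0//.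
suff : ((tail f S * a `^ S)%:E <= K).
  by rewrite KE lee_fin => /le_trans; apply; rewrite lerDl.
have mF : measurable_fun `]0%R, M[%classic
    (fun x => (a `^ rearrangement mu f x)%:E).
  apply/measurable_EFinP; apply: (measurableT_comp (measurable_powRr a)).
  exact: measurable_rearrangement.
have sub : `]0%R, tail f S[%classic `<=` `]0%R, M[%classic.
  move=> x /=; rewrite !in_itv/= => /andP[-> /lt_le_trans]; apply.
  exact/fine_measure_le/measurable_tail.
apply: (@le_trans _ _ (\int[lebesgue_measure]_(x in `]0%R, tail f S[%classic)
    (a `^ S)%:E)).
  rewrite integral_cst//= lebesgue_measure_itv/=.
  case: ifPn; first by rewrite -EFinD subr0 -EFinM mulrC.
  rewrite mule0 lte_fin -leNgt => fS0; rewrite lee_fin.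
  by rewrite mulr_le0_ge0// powR_ge0.
apply: (@le_trans _ _ (\int[lebesgue_measure]_(x in `]0%R, tail f S[%classic)
    (a `^ rearrangement mu f x)%:E)).
  apply: ge0_le_integral => //.
  - by move=> x _; rewrite lee_fin powR_ge0.
  - exact: measurable_funS mF.
  move=> x /=; rewrite in_itv/= => /andP[x0 xS]; rewrite lee_fin.
  by apply: ler_powR; [exact: ltW|exact: le_rearrangement].
by apply: ge0_subset_integral => // x _; rewrite lee_fin powR_ge0.
Qed.


End rearrangement.

(** * The limit of powers of the rearrangement of the inverse *)

Section limit.
Context {d : measure_display} {T : measurableType d} {R : realType}.
Variable mu : {finite_measure set T -> \bar R}.
Variable g : T -> R.
Hypothesis mg : measurable_fun setT g.
Local Open Scope ring_scope.

Let M : R := fine (mu setT).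
Let r := fun t => (g t)^-1.
Let mr : measurable_fun setT r. Proof. exact: measurable_funV. Qed.

(** Take x = M - m with m the tail of 1 / g at S. Then g^*(x) <= 1 / S, and the
    limit makes m ^ (1 / S) at most 1 / a as soon as m is small. For the
    remaining bounded range of S a constant suffices. *)
Lemma limit_superexp_tail :
  (M - x) `^ rearrangement mu g x @[x --> within `[0, M[%classic (nbhs M)] -->
    (0 : R) ->
  superexp_tail mu r.
Proof.
move=> /cvgrPdist_lt lim a a1; have a0 : 0 < a by lra.
have ia0 : 0 < a^-1 by rewrite invr_gt0.
have /nbhs_ballP[eta /= eta0 near_M] := lim _ ia0.
have M0 : 0 <= M by exact: fine_ge0.
have [|S0 S01 tS0] := @tail_small _ _ _ mu r (Num.min eta 1) mr.
  by rewrite lt_min eta0 ltr01.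
have aS0 : 1 <= a `^ S0 by rewrite -(powRr0 a); apply: ler_powR; lra.
exists ((M + 1) * a `^ S0) => [|S Sge0].
  by rewrite mulr_gt0 ?powR_gt0//; lra.
rewrite -mulrA; have [SS0|S0S] := leP S S0.
  have tM : tail mu r S <= M by exact/fine_measure_le/measurable_tail.
  have ? : 1 <= a `^ S0 * a `^ (- S).
    rewrite -powRD; last by rewrite (gt_eqF a0) implybT.
    by rewrite -(powRr0 a); apply: ler_powR; lra.
  nra.
set m := tail mu r S.
have [m0|m_gt0] := leP m 0.
  by rewrite (le_trans m0)// !mulr_ge0 ?powR_ge0//; lra.
have /andP[m_eta m1] : (m < eta) && (m < 1).
  by rewrite -lt_min (le_lt_trans _ tS0)// le_tail// ltW.
have mM : m <= M by exact/fine_measure_le/measurable_tail.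
have Spos : 0 < S by lra.
have gS : rearrangement mu g (M - m) <= S^-1.
  apply: rearrangement_le; first by rewrite invr_ge0.
  rewrite /Defs.distribution EFinB leeBrDr// -tailE//.
  have mD := @measurable_distribution_set _ _ _ g S^-1 mg.
  have mT := @measurable_tail _ _ _ r S mr.
  rewrite -[X in (_ <= X)%E]fin_measure// -measureU//.
    by apply: le_measure; rewrite ?inE//; exact: measurableU.
  apply/seteqP; split => // t [/= gS]; rewrite /r normfV.
  have g0 : 0 < `|g t| by apply: lt_trans gS; rewrite invr_gt0.
  by rewrite leNgt invf_plt ?posrE// gS.
have dM : `|M - (M - m)| < eta by rewrite opprB addrC subrK gtr0_norm.
have Dm : `[0, M[%classic (M - m).
  by rewrite /= in_itv/= subr_ge0 mM ltrBlDr ltrDl.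
have := near_M (M - m) dM Dm; rewrite sub0r normrN opprB addrC subrK.
rewrite (ger0_norm (powR_ge0 _ _)) => mg_lt.
have mS : m `^ S^-1 <= a^-1.
  apply: le_trans (ltW mg_lt); apply: ger_powR => //.
  by rewrite m_gt0 ltW.
have mE : m = (m `^ S^-1) `^ S.
  by rewrite -powRrM mulVf ?gt_eqF// powRr1// ltW.
have mle : m <= a `^ (- S).
  rewrite mE -mulN1r powRrM powR_inv1; last exact: ltW.
  by rewrite ge0_ler_powR ?nnegrE ?powR_ge0// ltW.
apply: (le_trans mle); rewrite mulrA ler_peMl ?powR_ge0//.
by rewrite mulr_ege1//; lra.
Qed.

(** With y = M - x, let s solve y ^ s = e. If g^*(x) < s then |g| < s on a set
    of measure at least y, and the decay at rate a = e ^ (-2), for which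
    a ^ (- 1 / s) = y ^ 2, gives y <= C y ^ 2. This fails for small y. *)
Lemma superexp_tail_limit : {ae mu, forall t, g t != 0} ->
  superexp_tail mu r ->
  (M - x) `^ rearrangement mu g x @[x --> within `[0, M[%classic (nbhs M)] -->
    (0 : R).
Proof.
move=> g0 rB; apply/cvgrPdist_lt => e0 e0_gt0.
(* Halving keeps the final inequality strict. *)
pose e := Num.min e0 1 / 2.
have /andP[e_gt0 /andP[ee0 e1]] : (0 < e) && ((e < e0) && (e < 1)).
  have : 0 < Num.min e0 1 by rewrite lt_min e0_gt0 ltr01.
  have : Num.min e0 1 <= e0 by rewrite ge_min lexx.
  have : Num.min e0 1 <= 1 by rewrite ge_min lexx orbT.
  rewrite /e => *; apply/andP; split; [lra|apply/andP; split; lra].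
have [|C C0 rC] := rB (e `^ (-2)).
  rewrite powRN powR_mulrn ?ltW// invf_gt1 ?exprn_gt0//.
  by rewrite expr_lt1// ltW.
have M0 : 0 <= M by exact: fine_ge0.
have [Mpos|M_le0] := ltP 0 M; last first.
  near=> x; have : `[0, M[%classic x by near: x; exact: withinT.
  rewrite /= in_itv/= => /andP[x0 /(le_lt_trans x0)]; lra.
pose eta := Num.min M (Num.min 1 C^-1).
have eta0 : 0 < eta by rewrite !lt_min Mpos ltr01 invr_gt0.
apply/nbhs_ballP; exists eta => //= x; rewrite /ball/= in_itv/=.
move=> Mx /andP[x0 xM]; have yM : 0 < M - x by lra.
move: Mx; rewrite gtr0_norm//; set y := M - x => y_eta.
have /and3P[y_ltM y_lt1 yC] : [&& y < M, y < 1 & y < C^-1] by rewrite -!lt_min.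
rewrite sub0r normrN ger0_norm ?powR_ge0//.
have lny : ln y < 0 by rewrite ln_lt0// yM.
have lne : ln e < 0 by rewrite ln_lt0// e_gt0.
pose s := ln e / ln y.
have s0 : 0 < s by rewrite /s -mulrNN -invrN divr_gt0 ?oppr_gt0.
have ys : y `^ s = e.
  by rewrite /powR gt_eqF// /s divfK ?lt_eqF// lnK.
apply: le_lt_trans ee0; rewrite -ys.
apply: ger_powR; first by rewrite yM ltW.
rewrite leNgt; apply/negP => gs.
have xpos : 0 < x by rewrite /y in y_ltM; lra.
have [s' [s'0 s's gs']] := rearrangement_lt mg xpos gs.
(* The space is covered by {s' < |g|}, of measure at most x, the tail of 1 / g
   at 1 / s, and the null set where g vanishes. *)
have yr : y <= tail mu r s^-1.
  have mD := @measurable_distribution_set _ _ _ g s' mg.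
  have mT := @measurable_tail _ _ _ r s^-1 mr.
  have mZ : measurable (g @^-1` [set 0]).
    by rewrite -[X in measurable X]setTI; exact: mg.
  have Z0 : (mu (g @^-1` [set 0%R]) <= 0)%E.
    suff -> : mu (g @^-1` [set 0]) = 0%E by [].
    apply/negligibleP => //.
    by apply: negligibleS g0 => t /= ->; rewrite eqxx.
  rewrite -lee_fin /y EFinB leeBlDr//.
  apply: (@le_trans _ _ (Defs.distribution mu g s' + (tail mu r s^-1)%:E)%E).
    rewrite /M -fin_measure// -tailE//.
    apply: (@le_trans _ _ (mu ([set t | s' < `|g t|] `|`
        ([set t | s^-1 <= `|r t|] `|` g @^-1` [set 0])))).
      apply: le_measure; rewrite ?inE//.
        by apply: measurableU => //; exact: measurableU.
      move=> t _ /=; have [gt0|gt0] := eqVneq (g t) 0; first by right; right.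
      have [?|gs''] := ltP s' `|g t|; [by left|right; left].
      rewrite /r normfV lef_pV2 ?posrE ?normr_gt0//.
      by rewrite (le_trans gs'')// ltW.
    apply: le_trans.
      by apply: measureU2 => //; exact: measurableU.
    rewrite leeD2l//; apply: le_trans; first by apply: measureU2.
    by rewrite -[leRHS]adde0; exact: leeD.
  by rewrite addeC leeD2l.
have := le_trans yr (rC s^-1 _); rewrite invr_ge0 ltW// => /(_ isT).
have -> : (e `^ (-2)) `^ (- s^-1) = y ^+ 2.
  rewrite -powRrM -{1}ys -powRrM -powR_mulrn ?ltW//; congr (_ `^ _).
  by field; rewrite gt_eqF.
apply/negP; rewrite -ltNge expr2 mulrA -[ltRHS]mul1r ltr_pM2r//.
by rewrite mulrC -ltr_pdivlMr// mul1r.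
Unshelve. all: by end_near.
Qed.

End limit.

(** * Weak compactness of the inclusion and disjoint sequences *)

Section ereal_limit.
Context {R : realType}.

Lemma cvge0P (u : (\bar R)^nat) : (forall n, 0 <= u n) ->
  u n @[n --> \oo] --> 0 <->
  forall e : R, (0 < e)%R -> \forall n \near \oo, u n <= e%:E.
Proof.
move=> u0; split=> [/fine_cvgP[ufin /cvgrPdist_le ulim] e e0|ulim].
  near=> n; rewrite -[u n]fineK; last by near: n.
  rewrite lee_fin; apply: le_trans (ler_norm _) _.
  by rewrite -normrN -sub0r; near: n; exact: ulim.
apply/fine_cvgP; split.
  near=> n; rewrite ge0_fin_numE// (@le_lt_trans _ _ 1%:E) ?ltry//.
  by near: n; exact: ulim.
apply/cvgrPdist_le => e e0; near=> n.
rewrite sub0r normrN ger0_norm ?fine_ge0//.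
have une : u n <= e%:E by near: n; exact: ulim.
rewrite -lee_fin fineK// ge0_fin_numE//.
by rewrite (le_lt_trans une) ?ltry.
Unshelve. all: by end_near. Qed.

End ereal_limit.

Section compactness.
Context {d : measure_display} {T : measurableType d} {R : realType}.
Variable mu : {finite_measure set T -> \bar R}.
Implicit Types (p q f g : T -> R) (r : R).

Lemma modular_cst0 p : exponent p -> modular mu p (cst 0%R) = 0.
Proof.
move=> [_ p1]; rewrite /modular.
rewrite (eq_integral (cst 0)) ?integral0// => t _ /=.
by rewrite normr0 powR0// gt_eqF// (lt_le_trans ltr01).
Qed.

Lemma Lvar_norm_cst0 p r : exponent p -> (0 < r)%R ->
  fs_norm (Lvar mu p) (cst 0%R) <= r%:E.
Proof.
move=> pe r0; apply: Lvar_norm_le => //.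
rewrite (_ : (fun _ => _) = cst 0%R) ?modular_cst0//.
by apply/funext => t; rewrite mul0r.
Qed.

Lemma Lvar_cst0 p : exponent p -> Lvar mu p (cst 0%R).
Proof.
move=> pe; apply: Lvar_memE => //.
by apply: (le_lt_trans (Lvar_norm_cst0 pe ltr01)); exact: ltry.
Qed.

(** With l = max (2 / e, 1) and L = l ^ Q, where Q bounds q, and b = 2 L in
    [powR_le_add], |f / e| ^ q is at most |f / 2| ^ p / 2 + L (2 L) ^ r. The
    first term integrates to at most 1/2 uniformly over the unit ball, and the
    second does not involve f. *)
Lemma L_weakly_compact_of_superexp_tail p q : exponent p -> exponent q ->
  {ae mu, forall t, (q t < p t)%R} -> ess_sup mu (EFin \o q) < +oo ->
  superexp_tail mu (fun t => p t / (p t - q t))%R ->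
  L_weakly_compact mu (Lvar mu p) (Lvar mu q) id.
Proof.
move=> pe qe qp /ess_supr_bounded[Q0 qQ0] tl A mA A0.
have [[mp p1] [mq q1]] := (pe, qe).
pose r t := (p t / (p t - q t))%R.
have mr : measurable_fun setT r.
  by apply: measurable_funM => //; apply/measurable_funV/measurable_funB.
apply/cvge0P => [n|e e0].
  apply: le_trans (Lvar_norm_ge0 mu q (fun t => cst 0 t * \1_(A n) t)%R) _.
  apply: ereal_sup_ubound; exists (cst 0%R) => //.
  split; first exact: Lvar_cst0.
  exact: Lvar_norm_cst0.
pose Q := Num.max Q0 1%R; pose l := Num.max (2 / e)%R 1%R.
have Q1 : (1 <= Q)%R by rewrite le_max lexx orbT.
have l1 : (1 <= l)%R by rewrite le_max lexx orbT.
have le : (2 / e <= l)%R by rewrite le_max lexx.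
pose L := (l `^ Q)%R; have L1 : (1 <= L)%R.
  by rewrite -(powRr0 l); apply: ler_powR => //; lra.
pose J t := (L * (2 * L) `^ `|r t|)%R.
have mJ : measurable_fun setT J.
  apply: measurable_funM => //.
  apply: (measurableT_comp (measurable_powRr (2 * L)%R)).
  exact: measurableT_comp.
have J0 t : (0 <= J t)%R by rewrite mulr_ge0 ?powR_ge0//; lra.
have mJA n : measurable_fun setT (fun t => (J t * \1_(A n) t)%:E).
  by apply/measurable_EFinP; exact: measurable_funM.
have : \int[mu]_t (J t * \1_(A n) t)%:E @[n --> \oo] --> 0.
  have [] := @dominated_convergence _ _ _ mu setT measurableT
    (fun n t => (J t * \1_(A n) t)%:E) (cst 0) (EFin \o J) mJA.
  - exact: measurable_cst.
  - apply: filterS A0 => t At _; apply: cvg_EFin; first exact: nearW.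
    by rewrite -(mulr0 (J t)); apply: cvgM At; exact: cvg_cst.
  - apply/integrableP; split; first exact/measurable_EFinP.
    under eq_integral => t _ do rewrite /= ger0_norm// EFinM.
    rewrite ge0_integralZl_EFin//; last by lra.
      apply: lte_mul_pinfty => //; rewrite ?lee_fin//; first by lra.
      by apply: superexp_tail_integrable tl _ _ => //; lra.
      by move=> t _; rewrite lee_fin powR_ge0.
    apply/measurable_EFinP/(measurableT_comp (measurable_powRr (2 * L)%R)).
    exact: measurableT_comp.
  - apply: aeW => t n _; rewrite lee_fin normrM !ger0_norm// ler_piMr//.
  by rewrite integral0 => _ _.
have J_ge0 n : 0 <= \int[mu]_t (J t * \1_(A n) t)%:E.
  by apply: integral_ge0 => t _; rewrite lee_fin mulr_ge0.
have half0 : (0 < 2^-1 :> R)%R by lra.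
move/(cvge0P J_ge0) => /(_ _ half0).
apply: filterS => n Jn.
apply/ereal_supP => _ [f [Ef f1] <-] /=.
have mf : measurable_fun setT f by case: Ef.
have mfA : measurable_fun setT (fun t => f t * \1_(A n) t / e)%R.
  by apply: measurable_funM => //; exact: measurable_funM.
have mf2 : measurable_fun setT (fun t => f t / 2)%R by exact: measurable_funM.
apply: Lvar_norm_le => //.
have f2 : modular mu p (fun t => f t / 2)%R <= 1.
  by apply: modular_le1 => //; rewrite (le_lt_trans f1)// lte_fin ltr1n.
apply: (@le_trans _ _ (\int[mu]_t
    ((2^-1)%:E * (`|f t / 2| `^ p t)%:E + (J t * \1_(A n) t)%:E))).
  apply: ae_ge0_le_integral => //.
  - exact: measurable_modular_fun.
  - move=> t _; rewrite adde_ge0// lee_fin ?mulr_ge0 ?powR_ge0//.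
  - apply: emeasurable_funD => //; apply: emeasurable_funM => //.
    exact: measurable_modular_fun.
  apply: filterS2 qp qQ0 => t qpt qQ _.
  rewrite -EFinM -EFinD lee_fin indicE.
  case: (t \in A n); last first.
    rewrite mulr0 mul0r normr0 powR0 ?mulr0 ?addr0 ?mulr_ge0 ?powR_ge0//.
    by have := q1 t; apply: contraTneq => ->; rewrite -ltNge.
  rewrite !mulr1; set u := `|f t / 2|%R.
  have u0 : (0 <= u)%R by exact: normr_ge0.
  have fu : (`|f t / e| <= l * u)%R.
    rewrite (_ : `|f t / e| = 2 / e * u)%R ?ler_wpM2r//.
    rewrite /u !normrM !normfV (gtr0_norm e0) (gtr0_norm (ltr0n _ 2)).
    by field; rewrite gt_eqF.
  have lu : (`|f t / e| `^ q t <= L * u `^ q t)%R.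
    apply: (@le_trans _ _ ((l * u) `^ q t)%R).
      have := q1 t; have lu0 : (0 <= l * u)%R by rewrite mulr_ge0//; lra.
      by move=> q1t; rewrite ge0_ler_powR ?nnegrE//; lra.
    rewrite powRM//; last by lra.
    rewrite ler_wpM2r ?powR_ge0//; apply: ler_powR => //.
    by rewrite le_max qQ.
  apply: (le_trans lu).
  have L2 : (1 <= 2 * L)%R by lra.
  have uq := powR_le_add u0 L2 (q1 t) qpt.
  have rr : ((2 * L) `^ (p t / (p t - q t)) <= (2 * L) `^ `|r t|)%R.
    by apply: ler_powR => //; exact: ler_norm.
  apply: (@le_trans _ _ (L * ((2 * L)^-1 * u `^ p t + (2 * L) `^ `|r t|))%R).
    rewrite ler_wpM2l//; first by lra.
    by apply: (le_trans uq); rewrite lerD2l.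
  rewrite mulrDr mulrA (_ : L * (2 * L)^-1 = 2^-1)%R//.
  by field; rewrite gt_eqF//; lra.
rewrite ge0_integralD//=; last 2 first.
- by apply: emeasurable_funM => //; exact: measurable_modular_fun.
- by move=> t _; rewrite lee_fin mulr_ge0.
rewrite ge0_integralZl_EFin//; last exact: measurable_modular_fun.
rewrite [leRHS](_ : 1 = (2^-1)%:E * 1 + (2^-1)%:E); last first.
  by rewrite mule1 -EFinD; congr EFin; lra.
by apply: leeD => //; apply: lee_pmul => //; exact: modular_ge0.
Qed.

(** Almost every point belongs to at most one of the supports, so their
    indicators tend to 0 and f_n is not changed by restriction to its own
    support. *)
Lemma M_weakly_compact_of_L p q : exponent p -> exponent q ->
  L_weakly_compact mu (Lvar mu p) (Lvar mu q) id ->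
  M_weakly_compact mu (Lvar mu p) (Lvar mu q) id.
Proof.
move=> pe qe Lw fs Efs [C0 fsC0] disj.
have mfs n : measurable_fun setT (fs n) by case: (Efs n).
(* A radius strictly above the given bound, as [modular_le1] requires. *)
pose C := (`|C0| + 1)%R; have C_gt0 : (0 < C)%R by rewrite ltr_wpDl.
pose gs n t := (fs n t / C)%R.
have mgs n : measurable_fun setT (gs n) by exact: measurable_funM.
have gs1 n : fs_norm (Lvar mu p) (gs n) <= 1.
  apply: Lvar_norm_le => //.
  rewrite (_ : (fun _ => _) = gs n); last by apply/funext => t; rewrite divr1.
  apply: modular_le1 => //; rewrite (le_lt_trans (fsC0 n))// lte_fin /C.
  by rewrite (le_lt_trans (ler_norm C0))// ltrDl.
pose A n := [set t | fs n t != 0%R].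
have mA n : measurable (A n).
  rewrite (_ : A n = ~` (fs n @^-1` [set 0%R])).
    by apply: measurableC; rewrite -[X in measurable X]setTI; exact: mfs.
  by apply/seteqP; split => t /= /eqP.
have fsA n t : (fs n t * \1_(A n) t = fs n t)%R.
  rewrite indicE; have [ft0|ft0] := eqVneq (fs n t) 0%R.
    by rewrite ft0 mul0r.
  by rewrite mem_set// mulr1.
have /(Lw _ mA) : {ae mu, forall t,
    (\1_(A n) t : R) @[n --> \oo] --> (0 : R)%R}.
  have : {ae mu, forall t, forall m n, m != n ->
      Num.min `|fs m t|%R `|fs n t|%R = 0%R}.
    apply: ae_foralln => m; apply: ae_foralln => n.
    have [->|mn] := eqVneq m n; first by apply: aeW.
    by apply: filterS (disj _ _ mn) => t.
  apply: filterS => t dt; apply: cvg_near_cst.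
  have [[m fmt]|f0] := pselect (exists m, fs m t != 0%R).
    exists m.+1 => // n /= mn; rewrite indicE memNset// /A/= => fnt.
    have := dt m n; rewrite (ltn_eqF mn) => /(_ isT); apply/eqP.
    by rewrite gt_eqF// lt_min !normr_gt0 fmt.
  apply: nearW => n; rewrite indicE memNset// /A/= => fnt.
  by apply: f0; exists n.
have sup_ge n : fs_norm (Lvar mu q) (fun t => gs n t * \1_(A n) t)%R <=
    ereal_sup [set fs_norm (Lvar mu q) (fun t => id f t * \1_(A n) t)%R
              | f in unit_ball (Lvar mu p)].
  apply: ereal_sup_ubound; exists (gs n) => //; split => //.
  by apply: Lvar_memE => //; rewrite (le_lt_trans (gs1 n))// ltry.
move/cvge0P => sup0; apply/cvge0P => [n|e e0]; first exact: Lvar_norm_ge0.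
have eC : (0 < e / C / 2)%R by rewrite !divr_gt0.
have : forall n, 0 <= ereal_sup [set fs_norm (Lvar mu q)
    (fun t => id f t * \1_(A n) t)%R | f in unit_ball (Lvar mu p)].
  by move=> n; apply: le_trans (sup_ge n); exact: Lvar_norm_ge0.
move=> /sup0/(_ _ eC); apply: filterS => n /(le_trans (sup_ge n)) gn.
apply: Lvar_norm_le => //.
rewrite (_ : (fun _ => _) = fun t => (gs n t * \1_(A n) t) / (e / C))%R.
  apply: modular_le1 => //; first exact: measurable_funM.
  rewrite (le_lt_trans gn)// lte_fin ltr_pdivrMr// ltr_pMr ?divr_gt0//.
  by rewrite ltr1n.
apply/funext => t; rewrite -[in LHS]fsA /gs; field.
by rewrite !gt_eqF.
Qed.

(** In a combination indexed by k < n + 1, f_n itself has coefficients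
    [k == n]. *)
Lemma closed_span_mem p (fs : (T -> R)^nat) n : exponent p ->
  Lvar mu p (fs n) -> closed_span (Lvar mu p) fs (fs n).
Proof.
move=> pe Efs; split => // e e0; exists n.+1, (fun k => (k == n)%:R).
rewrite (_ : (fun _ => _) = cst 0%R).
  apply: (@le_lt_trans _ _ (e / 2)%:E); last by rewrite lte_fin; lra.
  by apply: Lvar_norm_cst0; rewrite ?divr_gt0.
apply/funext => t; rewrite big_ord_recr/= eqxx mul1r big1 ?add0r ?subrr//.
by move=> i _; rewrite (ltn_eqF (ltn_ord i)) mul0r.
Qed.

Lemma DSS_of_M_weakly_compact p q : exponent p ->
  M_weakly_compact mu (Lvar mu p) (Lvar mu q) id ->
  disjointly_strictly_singular mu (Lvar mu p) (Lvar mu q) id.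
Proof.
move=> pe Mw [fs [Efs fs1 disj [c c0 iso]]].
have /cvge0P : fs_norm (Lvar mu q) (id (fs n)) @[n --> \oo] --> 0.
  by apply: Mw => //; exists 1%R => n; rewrite fs1.
have nn n : 0 <= fs_norm (Lvar mu q) (id (fs n)) by exact: Lvar_norm_ge0.
have c2 : (0 < c / 2)%R by rewrite divr_gt0.
move=> /(_ nn _ c2) [N _ /(_ N (leqnn N))/=].
have := iso _ (closed_span_mem pe (Efs N)).
rewrite fs1 mule1 => /le_trans/[apply]; rewrite lee_fin; lra.
Qed.

Lemma measurable_normalized_indic p (A : set T) : measurable_fun setT p ->
  measurable A -> measurable_fun setT (normalized_indic mu p A).
Proof.
move=> mp mA; apply: measurable_funM; first exact: measurable_indic.
apply: measurable_funV; apply: (measurableT_comp (measurable_powRr _)).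
exact: measurable_funV.
Qed.

(** The normalization is chosen so that the variable exponent disappears. *)
Lemma normalized_indic_powR p (A : set T) t : (1 <= p t)%R ->
  (0 < fine (mu A))%R ->
  (`|normalized_indic mu p A t| `^ p t = (fine (mu A))^-1 * \1_A t)%R.
Proof.
move=> p1 A0; rewrite /normalized_indic indicE.
case: (t \in A); last first.
  by rewrite mul0r normr0 mulr0 powR0// gt_eqF// (lt_le_trans ltr01).
rewrite mul1r mulr1 ger0_norm ?invr_ge0 ?powR_ge0// -powRN -powRrM mulNr.
by rewrite mulVf ?powR_inv1 ?ltW// gt_eqF// (lt_le_trans ltr01).
Qed.

Lemma modular_normalized_indic p (A : set T) : exponent p -> measurable A ->
  0 < mu A -> modular mu p (normalized_indic mu p A) = 1.
Proof.
move=> [mp p1] mA A0; rewrite /modular.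
have fA0 : (0 < fine (mu A))%R by rewrite -lte_fin -fin_measure.
under eq_integral => t _ do rewrite normalized_indic_powR// EFinM.
rewrite ge0_integralZl_EFin// ?invr_ge0 ?ltW//; last first.
  by apply/measurable_EFinP; exact: measurable_indic.
rewrite integral_indic// setIT [X in _ * X]fin_measure// -EFinM mulVf//.
by rewrite gt_eqF.
Qed.

(** For s < 1 the modular of f / s is at least s ^ (-1) times that of f, because
    p >= 1; hence no radius below 1 is admissible. *)
Lemma Lvar_norm_normalized_indic p (A : set T) : exponent p -> measurable A ->
  0 < mu A -> fs_norm (Lvar mu p) (normalized_indic mu p A) = 1.
Proof.
move=> pe mA A0; have [mp p1] := pe.
have mf := measurable_normalized_indic mp mA.
apply/eqP; rewrite eq_le; apply/andP; split.
  apply: Lvar_norm_le => //.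
  rewrite (_ : (fun _ => _) = normalized_indic mu p A).
    by rewrite modular_normalized_indic.
  by apply/funext => t; rewrite divr1.
apply/ereal_infP => _ [s [s0 fs] <-]; rewrite leNgt lte_fin; apply/negP => s1.
suff : (s^-1)%:E <= 1 by rewrite lee_fin invf_le1//; lra.
apply: le_trans fs; rewrite -[leLHS]mule1 -(modular_normalized_indic pe mA A0).
rewrite /modular -ge0_integralZl_EFin//; last 2 first.
- exact: measurable_modular_fun.
- by rewrite invr_ge0 ltW.
apply: ge0_le_integral => //.
- by move=> t _; rewrite mule_ge0// lee_fin ?powR_ge0 ?invr_ge0 ?ltW.
- by apply: emeasurable_funM => //; exact: measurable_modular_fun.
- by apply: measurable_modular_fun => //; exact: measurable_funM.
move=> t _; rewrite -EFinM lee_fin; move: (normalized_indic mu p A t) => u.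
rewrite normrM powRM//.
have s_ge0 : (0 <= s^-1)%R by rewrite invr_ge0 ltW.
rewrite mulrC ler_wpM2l ?powR_ge0// ger0_norm//.
by rewrite le1r_powR// invf_ge1// ltW.
Qed.

Lemma disjoint_normalized_indic p (A : (set T)^nat) : trivIset setT A ->
  disjoint_seq mu (fun n => normalized_indic mu p (A n)).
Proof.
move=> tA m n mn; apply: aeW => t.
have [At|nAt] := pselect (A m t); last first.
  rewrite /normalized_indic indicE memNset// mul0r normr0.
  by apply/min_idPl.
have nAt : ~ A n t.
  by move=> Ant; move/eqP : mn; apply; apply: tA => //; exists t.
rewrite minC /normalized_indic indicE memNset// mul0r normr0.
by apply/min_idPl.
Qed.

Lemma not_iso_on_indic_of_DSS p q (A : (set T)^nat) : exponent p ->
  disjointly_strictly_singular mu (Lvar mu p) (Lvar mu q) id ->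
  (forall n, measurable (A n)) -> (forall n, 0 < mu (A n)) ->
  trivIset setT A ->
  ~ iso_on (Lvar mu p) (Lvar mu q) id
      (closed_span (Lvar mu p) (fun n => normalized_indic mu p (A n))).
Proof.
move=> pe dss mA A0 tA iso; apply: dss.
exists (fun n => normalized_indic mu p (A n)); split => //.
- move=> n; apply: Lvar_memE => //.
    by case: pe => mp _; exact: measurable_normalized_indic.
  by rewrite Lvar_norm_normalized_indic// ltry.
- by move=> n; exact: Lvar_norm_normalized_indic.
- exact: disjoint_normalized_indic.
Qed.

End compactness.

(** * Quasi-triangle inequality and continuity of the inclusion *)

Section quasinorm.
Context {d : measure_display} {T : measurableType d} {R : realType}.
Variable mu : {finite_measure set T -> \bar R}.
Implicit Types (p q f g h : T -> R) (r : R).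

Let M : R := fine (mu setT).

Lemma powR_add_le (x y z p : R) : (0 <= x)%R -> (0 <= y)%R -> (0 <= z)%R ->
  (1 <= p)%R -> (z <= x + y)%R ->
  ((z / 4) `^ p <= 2^-1 * (x `^ p + y `^ p))%R.
Proof.
move=> x0 y0 z0 p1 zxy.
have [m [xm ym mp]] : exists m,
    [/\ x <= m, y <= m & m `^ p <= x `^ p + y `^ p]%R.
  have [xy|/ltW yx] := leP x y.
    by exists y; split => //; rewrite lerDr powR_ge0.
  by exists x; split => //; rewrite lerDl powR_ge0.
have p0 : (0 <= p)%R by lra.
apply: (@le_trans _ _ ((2^-1 * m) `^ p)%R).
  by rewrite ge0_ler_powR ?nnegrE//; lra.
apply: (@le_trans _ _ (2^-1 * m `^ p)%R).
  by apply: ge1r_powRZ => //; lra.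
by rewrite ler_wpM2l//; lra.
Qed.

(** A quasi-triangle inequality is enough for passing from a span to its
    closure, and it needs only max (x, y) instead of the convexity of powers.
    Dominating |h| by |f| + |g| covers sums and differences alike. *)
Lemma Lvar_norm_add p f g h r : exponent p -> measurable_fun setT f ->
  measurable_fun setT g -> measurable_fun setT h ->
  (forall t, (`|h t| <= `|f t| + `|g t|)%R) ->
  fs_norm (Lvar mu p) f < r%:E -> fs_norm (Lvar mu p) g < r%:E ->
  fs_norm (Lvar mu p) h <= (4 * r)%:E.
Proof.
move=> pe mf mg mh hfg fr gr; have [mp p1] := pe.
have r0 : (0 < r)%R.
  by rewrite -lte_fin; apply: le_lt_trans fr; exact: Lvar_norm_ge0.
have mfr : measurable_fun setT (fun t => f t / r)%R by exact: measurable_funM.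
have mgr : measurable_fun setT (fun t => g t / r)%R by exact: measurable_funM.
apply: Lvar_norm_le; first by rewrite mulr_gt0.
apply: (@le_trans _ _ (\int[mu]_t ((2^-1)%:E *
    ((`|f t / r| `^ p t)%:E + (`|g t / r| `^ p t)%:E)))).
  apply: ge0_le_integral => //.
  - by apply: measurable_modular_fun => //; exact: measurable_funM.
  - apply: emeasurable_funM => //; apply: emeasurable_funD => //;
      exact: measurable_modular_fun.
  move=> t _; rewrite -EFinD -EFinM lee_fin.
  have -> : (`|h t / (4 * r)| = `|h t / r| / 4)%R.
    by rewrite invfM mulrA mulrAC normrM (@ger0_norm _ 4^-1).
  apply: powR_add_le => //.
  by rewrite !normrM -mulrDl ler_wpM2r.
rewrite ge0_integralZl_EFin//; last 2 first.
- by move=> t _; rewrite adde_ge0// lee_fin powR_ge0.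
- by apply: emeasurable_funD => //; exact: measurable_modular_fun.
rewrite ge0_integralD//; [|exact: measurable_modular_fun..].
rewrite [leRHS](_ : 1 = (2^-1)%:E * (1 + 1)); last first.
  by rewrite -EFinD -EFinM; congr EFin; lra.
apply: lee_pmul => //; first by rewrite adde_ge0//; exact: modular_ge0.
by apply: leeD; exact: modular_le1.
Qed.

(** Since u ^ q <= 1 + u ^ p, the q-modular at the same radius is at most
    M + 1; dividing by M + 1 >= 1 brings it below 1 as q >= 1. *)
Lemma Lvar_norm_inclusion p q h r : exponent p -> exponent q ->
  {ae mu, forall t, (q t < p t)%R} -> measurable_fun setT h ->
  fs_norm (Lvar mu p) h < r%:E ->
  fs_norm (Lvar mu q) h <= ((M + 1) * r)%:E.
Proof.
move=> pe qe qp mh hr; have [[mp p1] [mq q1]] := (pe, qe).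
have M0 : (0 <= M)%R by exact: fine_ge0.
have r0 : (0 < r)%R.
  by rewrite -lte_fin; apply: le_lt_trans hr; exact: Lvar_norm_ge0.
have mhr : measurable_fun setT (fun t => h t / r)%R by exact: measurable_funM.
have K0 : (0 < (M + 1)^-1 <= 1)%R.
  have M1 : (0 < M + 1)%R by lra.
  by rewrite invr_gt0 invf_le1// M1/=; lra.
apply: Lvar_norm_le; first by rewrite mulr_gt0//; lra.
apply: (@le_trans _ _ (\int[mu]_t ((M + 1)^-1%:E *
    (1 + (`|h t / r| `^ p t)%:E)))).
  apply: ae_ge0_le_integral => //.
  - by apply: measurable_modular_fun => //; exact: measurable_funM.
  - move=> t _; rewrite mule_ge0 ?adde_ge0 ?lee_fin ?powR_ge0//; lra.
  - apply: emeasurable_funM => //; apply: emeasurable_funD => //.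
    exact: measurable_modular_fun.
  apply: filterS qp => t qpt _; rewrite -EFinD -EFinM lee_fin.
  have -> : (`|h t / ((M + 1) * r)| = (M + 1)^-1 * `|h t / r|)%R.
    rewrite invfM mulrCA normrM ger0_norm//; lra.
  apply: le_trans (ge1r_powRZ _ _ _) _ => //.
  rewrite ler_wpM2l//; first by lra.
  set u := `|h t / r|%R; have u0 : (0 <= u)%R by exact: normr_ge0.
  have [u1|u1] := leP u 1%R.
    apply: ler_wpDr; first exact: powR_ge0.
    have [->|un0] := eqVneq u 0%R.
      by rewrite powR0// gt_eqF// (lt_le_trans ltr01).
    rewrite -(powRr0 u); apply: ger_powR; last by rewrite (le_trans ler01).
    by rewrite lt_neqAle eq_sym un0 u0.
  apply: ler_wpDl => //; apply: ler_powR; lra.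
rewrite ge0_integralZl_EFin//; last 3 first.
- by move=> t _; rewrite adde_ge0// lee_fin powR_ge0.
- by apply: emeasurable_funD => //; exact: measurable_modular_fun.
- lra.
rewrite ge0_integralD//; last exact: measurable_modular_fun.
rewrite integral_cst// mul1e.
rewrite [leRHS](_ : 1 = (M + 1)^-1%:E * (M%:E + 1)); last first.
  by rewrite -EFinD -EFinM mulVf// gt_eqF//; lra.
apply: lee_pmul => //; first by rewrite lee_fin; lra.
- by rewrite adde_ge0//; exact: modular_ge0.
- by apply: leeD; [rewrite /M -fin_measure|exact: modular_le1].
Qed.

End quasinorm.

(** * Spans of normalized indicators *)

Section indicators.
Context {d : measure_display} {T : measurableType d} {R : realType}.
Variable mu : {finite_measure set T -> \bar R}.
Variables p q : T -> R.
Hypotheses (pe : exponent p) (qe : exponent q).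
Hypothesis qp : {ae mu, forall t, (q t < p t)%R}.
Variable A : (set T)^nat.
Hypotheses (mA : forall n, measurable (A n)) (A0 : forall n, 0 < mu (A n)).
Hypothesis tA : trivIset setT A.
Variable delta : R.
Hypothesis delta01 : (0 < delta <= 1)%R.
Hypothesis Adelta : forall n, {ae mu, forall t, A n t ->
  (delta <= fine (mu (A n)) `^ ((p t - q t) / p t))%R}.

Let e n := normalized_indic mu p (A n).
Let m n : R := fine (mu (A n)).
Let m0 n : (0 < m n)%R. Proof. by rewrite -lte_fin -fin_measure. Qed.

(** At each point at most one term of a combination survives, which allows
    both modulars of a combination to be compared pointwise. *)
Lemma sum_normalized_indic (a : nat -> R) n j t : A j t ->
  (\sum_(k < n) a k * e k t = if (j < n)%N then a j * e j t else 0)%R.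
Proof.
move=> Ajt.
have ek0 k : k != j -> e k t = 0%R.
  move=> kj; rewrite /e /normalized_indic indicE memNset ?mul0r// => Akt.
  by move/eqP : kj; apply; apply: tA => //; exists t.
case: ifPn => jn.
  rewrite (bigD1 (Ordinal jn))//= big1 ?addr0// => k kj.
  by rewrite ek0 ?mulr0//; apply: contra kj => /eqP kj; apply/eqP/val_inj.
rewrite big1// => k _; rewrite ek0 ?mulr0//.
by apply: contraNneq jn => <-.
Qed.

(** Since q / p = 1 - (p - q) / p, measuring with q what is normalized for p
    leaves the factor m ^ ((p - q) / p), which delta bounds from below. *)
Lemma normalized_indic_powR_q b j t : A j t -> (0 <= b)%R ->
  ((b * `|e j t|) `^ q t = b `^ q t * (m j `^ ((p t - q t) / p t) / m j))%R.
Proof.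
move=> Ajt b0; have [[mp p1] [mq q1]] := (pe, qe).
have pt0 : (p t != 0)%R by rewrite gt_eqF// (lt_le_trans ltr01).
rewrite powRM//; congr (_ * _)%R.
rewrite /e /normalized_indic indicE mem_set// mul1r.
rewrite ger0_norm ?invr_ge0 ?powR_ge0//.
rewrite -/(m j) -powRN -powRrM.
have -> : (- (p t)^-1 * q t = (p t - q t) / p t - 1)%R by field.
rewrite powRB ?powRr1//; first exact: ltW.
by rewrite (gt_eqF (m0 j)) implybT.
Qed.

(** A q-modular at most 1 forces every coefficient to satisfy
    delta |a_j| / r <= 1: otherwise A_j alone would contribute more than 1. For
    a base at most 1 powers decrease with the exponent, so p may be replaced
    by the smaller q, and the factor delta ^ q <= delta that appears pays for
    m ^ ((p - q) / p). *)
Lemma modular_span (a : nat -> R) n r : (0 < r)%R ->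
  modular mu q (fun t => (\sum_(k < n) a k * e k t) / r)%R <= 1 ->
  modular mu p (fun t => (\sum_(k < n) a k * e k t) / (r / delta))%R <= 1.
Proof.
move=> r0 s1; have [[mp p1] [mq q1]] := (pe, qe).
have /andP[d0 d1] := delta01.
pose s t := (\sum_(k < n) a k * e k t)%R.
have ms : measurable_fun setT s.
  apply: measurable_sum => k; apply: measurable_funM => //.
  exact: measurable_normalized_indic.
have mqs : measurable_fun setT (fun t => (`|s t / r| `^ q t)%:E).
  by apply: measurable_modular_fun => //; exact: measurable_funM.
have sE j t : (j < n)%N -> A j t -> (`|s t / r| = `|a j| / r * `|e j t|)%R.
  move=> jn Ajt; rewrite /s (sum_normalized_indic _ _ Ajt) jn.
  rewrite (normrM (a j * e j t)%R) (normrM (a j)) normfV (gtr0_norm r0).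
  by rewrite mulrAC.
have coef j : (j < n)%N -> (delta * (`|a j| / r) <= 1)%R.
  move=> jn; rewrite leNgt; apply/negP => db1; set b := (`|a j| / r)%R.
  have b0 : (0 <= b)%R by rewrite divr_ge0// ltW.
  have b1 : (1 <= b)%R by rewrite -/b in db1; nra.
  suff : (delta * b)%:E <= 1 by rewrite lee_fin leNgt db1.
  apply: le_trans s1.
  apply: (@le_trans _ _ (\int[mu]_(t in A j)
      (`|s t / r| `^ q t)%:E)); last first.
    by apply: ge0_subset_integral => // t _; rewrite lee_fin powR_ge0.
  apply: (@le_trans _ _ (\int[mu]_(t in A j) (delta * b / m j)%:E)).
    rewrite integral_cst// [X in _ * X]fin_measure// -/(m j) -EFinM.
    by rewrite divfK ?gt_eqF.
  apply: ae_ge0_le_integral => //.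
  - by move=> t _; rewrite lee_fin !mulr_ge0 ?invr_ge0// ltW.
  - exact: measurable_funS mqs.
  apply: filterS (Adelta j) => t dt At; rewrite lee_fin.
  rewrite (sE _ _ jn At) normalized_indic_powR_q// -/b [leRHS]mulrA.
  rewrite ler_pM2r ?invr_gt0// [leRHS]mulrC.
  by apply: ler_pM => //; [exact: ltW|exact: dt|exact: le1r_powR].
apply: le_trans s1.
apply: ae_le_modular => //; [exact: measurable_funM|exact: measurable_funM|].
apply: filterS2 qp (ae_foralln Adelta) => t qpt dt; rewrite -/(s t).
have [[j Ajt]|nA] := pselect (exists j, A j t); last first.
  have -> : s t = 0%R.
    rewrite /s big1// => k _; rewrite /e /normalized_indic indicE memNset.
      by rewrite mul0r mulr0.
    by move=> Akt; apply: nA; exists k.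
  by rewrite !mul0r normr0 !powR0// gt_eqF// (lt_le_trans ltr01).
have [jn|jn] := boolP (j < n)%N; last first.
  rewrite /s (sum_normalized_indic _ _ Ajt) (negbTE jn).
  by rewrite !mul0r normr0 !powR0// gt_eqF// (lt_le_trans ltr01).
set b := (`|a j| / r)%R.
have b0 : (0 <= b)%R by rewrite divr_ge0// ltW.
have db0 : (0 <= delta * b)%R by rewrite mulr_ge0// ltW.
have -> : (`|s t / (r / delta)| = delta * b * `|e j t|)%R.
  rewrite -mulrA -(sE _ _ jn Ajt) invfM invrK mulrA normrM mulrC.
  by rewrite gtr0_norm.
rewrite (sE _ _ jn Ajt) normalized_indic_powR_q// -/b.
rewrite powRM// (normalized_indic_powR (p1 t) (m0 j)) indicE mem_set// mulr1.
rewrite -/(m j) mulrA.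
rewrite ler_pM2r ?invr_gt0//.
apply: (@le_trans _ _ ((delta * b) `^ q t)%R).
  have [->|db_neq0] := eqVneq (delta * b)%R 0%R.
    by rewrite !powR0// gt_eqF// (lt_le_trans ltr01).
  by apply: ger_powR; [rewrite lt_neqAle eq_sym db_neq0 db0 coef|exact: ltW].
rewrite powRM//; last exact: ltW.
rewrite mulrC ler_wpM2l ?powR_ge0//; apply: le_trans (dt j Ajt).
exact: ge1r_powR.
Qed.

(** For combinations this is [modular_span]. An element g of the closure is
    compared with a combination s so close to g in the p-norm that g - s is
    negligible in both norms; the two quasi-triangle inequalities account for
    the constant 48. *)
Lemma iso_on_span_indic :
  iso_on (Lvar mu p) (Lvar mu q) id (closed_span (Lvar mu p) e).
Proof.
have /andP[d0 d1] := delta01.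
have [[mp p1] [mq q1]] := (pe, qe).
pose M : R := fine (mu setT); have M0 : (0 <= M)%R by exact: fine_ge0.
exists (delta / 48)%R; first by rewrite divr_gt0.
move=> g [[mg _] gspan]; apply/ereal_infP => _ [r [r0 gr] <-].
have {gr} g2r : fs_norm (Lvar mu q) g < (2 * r)%:E.
  by rewrite (le_lt_trans (Lvar_norm_le r0 gr))// lte_fin; lra.
(* The inclusion multiplies norms by at most M + 1. *)
have eps0 : (0 < 2 * r / (M + 1) / 2)%R.
  by rewrite !divr_gt0 ?mulr_gt0//; lra.
have [n [a gs]] := gspan _ eps0.
set eps := (_ / 2)%R in eps0 gs.
pose s t := (\sum_(k < n) a k * e k t)%R.
have ms : measurable_fun setT s.
  apply: measurable_sum => k; apply: measurable_funM => //.
  exact: measurable_normalized_indic.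
have mgs : measurable_fun setT (fun t => g t - s t)%R by exact: measurable_funB.
have gsq : fs_norm (Lvar mu q) (fun t => g t - s t)%R < (2 * r)%:E.
  apply: le_lt_trans (Lvar_norm_inclusion pe qe qp mgs gs) _.
  rewrite lte_fin -/M /eps (_ : (M + 1) * _ = r)%R; last by field; lra.
  lra.
have sq : fs_norm (Lvar mu q) s <= (4 * (2 * r))%:E.
  apply: (Lvar_norm_add qe mg mgs ms _ g2r gsq) => t.
  rewrite [X in (`|X| <= _)%R](_ : _ = g t - (g t - s t))%R ?ler_normB//.
  by lra.
have sp : fs_norm (Lvar mu p) s <= (10 * r / delta)%:E.
  apply: Lvar_norm_le; first by rewrite divr_gt0// mulr_gt0.
  apply: modular_span; first by rewrite mulr_gt0.
  by apply: modular_le1 => //; rewrite (le_lt_trans sq)// lte_fin; lra.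
have sp12 : fs_norm (Lvar mu p) s < (12 * r / delta)%:E.
  by rewrite (le_lt_trans sp)// lte_fin ltr_pM2r ?invr_gt0//; lra.
have gs12 : fs_norm (Lvar mu p) (fun t => g t - s t)%R < (12 * r / delta)%:E.
  apply: lt_trans gs _; rewrite lte_fin; apply: (@le_lt_trans _ _ r).
    rewrite /eps (_ : _ / 2 = r / (M + 1))%R; last by field; lra.
    by rewrite ler_pdivrMr; nra.
  rewrite ltr_pdivlMr//; nra.
have gp : fs_norm (Lvar mu p) g <= (4 * (12 * r / delta))%:E.
  apply: (Lvar_norm_add pe ms mgs mg _ sp12 gs12) => t.
  rewrite [X in (`|X| <= _)%R](_ : _ = s t + (g t - s t))%R ?ler_normD//.
  by lra.
apply: (@le_trans _ _ ((delta / 48)%:E * (4 * (12 * r / delta))%:E)).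
  apply: lee_pmul => //; last exact: Lvar_norm_ge0.
  by rewrite lee_fin divr_ge0// ltW.
rewrite -EFinM lee_fin le_eqVlt; apply/orP; left; apply/eqP; field.
by rewrite gt_eqF.
Qed.

End indicators.

(** * Disjoint level sets of a function with a heavy tail *)

Section level_sets.
Context {d : measure_display} {T : measurableType d} {R : realType}.
Variable mu : {finite_measure set T -> \bar R}.
Variable r : T -> R.
Hypothesis mr : measurable_fun setT r.
Local Open Scope ring_scope.

Let M : R := fine (mu setT).
Let M0 : 0 <= M. Proof. exact: fine_ge0. Qed.
Let tM S : tail mu r S <= M.
Proof. exact/fine_measure_le/measurable_tail. Qed.

(** Halving the tail takes S' beyond some level S0. Applying the failure of
    decay with the constant C = (mu(T) + 1) a ^ S0 yields such an S', since for
    S' < S0 the bound C a ^ (- S') would exceed the total mass. *)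
Lemma heavy_tail_step a S : 1 < a ->
  (forall C, 0 < C -> exists2 S, 0 <= S & C * a `^ (- S) < tail mu r S) ->
  0 < tail mu r S ->
  exists S', [/\ 1 <= S', S <= S', a `^ (- S') <= tail mu r S' &
    tail mu r S' <= tail mu r S / 2].
Proof.
move=> a1 heavy tS; have a0 : 0 < a by lra.
have [|S1 S1_ge1 tS1] := @tail_small _ _ _ mu r (tail mu r S / 2) mr.
  by rewrite divr_gt0.
pose S0 := Num.max S1 S.
have S1S0 : S1 <= S0 by rewrite le_max lexx.
have SS0 : S <= S0 by rewrite le_max lexx orbT.
have aS0 : 1 <= a `^ S0 by rewrite -(powRr0 a); apply: ler_powR; lra.
pose C := (M + 1) * a `^ S0.
have C1 : 1 <= C by rewrite /C mulr_ege1//; move: M0; lra.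
have [|S' S'0 tS'] := heavy C; first by lra.
have S0S' : S0 <= S'.
  rewrite leNgt; apply/negP => S'S0.
  have : M + 1 <= C * a `^ (- S').
    rewrite /C -mulrA -powRD; last by rewrite (gt_eqF a0) implybT.
    rewrite ler_peMr//; first by move: M0; lra.
    by rewrite -(powRr0 a); apply: ler_powR; lra.
  by have := tM S'; lra.
exists S'; split.
- lra.
- lra.
- apply: ltW; apply: le_lt_trans tS'.
  by rewrite ler_peMl// powR_ge0.
- by rewrite ltW// (le_lt_trans _ tS1)// le_tail//; lra.
Qed.

(** The sets are differences of consecutive superlevel sets along the levels
    of [heavy_tail_step]. Removing the next level costs at most half of the
    measure, and as S_n >= 1 the factor 1/2 is absorbed by passing from a to
    2 a. *)
Lemma disjoint_level_sets : ~ superexp_tail mu r ->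
  exists a (S : nat -> R) (A : (set T)^nat),
  [/\ 1 < a /\ (forall n, measurable (A n)), trivIset setT A,
      forall n, 1 <= S n, forall n t, A n t -> S n <= `|r t| &
      forall n, a `^ (- S n) <= fine (mu (A n))].
Proof.
move=> /existsNP[a /not_implyP[a1 nB]]; have a0 : 0 < a by lra.
have heavy C : 0 < C -> exists2 S, 0 <= S & C * a `^ (- S) < tail mu r S.
  move=> C0; apply: contrapT => nS; apply: nB; exists C => // S S0.
  by rewrite leNgt; apply/negP => tS; apply: nS; exists S.
pose X := {S : R | 0 < tail mu r S}.
pose next (x y : X) := [/\ 1 <= val y, val x <= val y,
  a `^ (- val y) <= tail mu r (val y) &
  tail mu r (val y) <= tail mu r (val x) / 2].
have step (x : X) : {y : X | next x y}.
  apply: cid; have [S' [S'1 xS' aS' tS']] := heavy_tail_step a1 heavy (valP x).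
  have tS'0 : 0 < tail mu r S' by rewrite (lt_le_trans _ aS')// powR_gt0.
  by exists (exist _ S' tS'0).
have [S0 _ tS0] := heavy 1 ltr01.
have tS00 : 0 < tail mu r S0 by rewrite (le_lt_trans _ tS0)// mul1r powR_ge0.
have [f [_ fnext]] := dependent_choice step (exist _ S0 tS00).
pose S n := val (f n.+1).
have Smono m n : (m <= n)%N -> S m <= S n.
  move=> /subnK <-; elim: (n - m)%N => [|k IH]; first by rewrite add0n.
  by rewrite addSn (le_trans IH)//; have [] := fnext (k + m).+1.
pose H n := [set t | S n <= `|r t|].
have mH n : measurable (H n) by exact: measurable_tail.
exists (2 * a), S, (fun n => H n `\` H n.+1); split.
- by split; [lra|move=> n; exact: measurableD].
- have disj i j : (i < j)%N -> (H i `\` H i.+1) `&` (H j `\` H j.+1) = set0.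
    move=> ij; apply/seteqP; split => // t [[_ /negP]].
    rewrite -ltNge => tSi [/= Sj _].
    by have := Smono _ _ ij; rewrite leNgt (le_lt_trans Sj tSi).
  apply/trivIsetP => i j _ _; rewrite neq_ltn => /orP[|] ij; first exact: disj.
  by rewrite setIC; exact: disj.
- by move=> n; have [] := fnext n.
- by move=> n t [].
move=> n; have [S1 _ aS _] := fnext n; have [_ _ _ tS] := fnext n.+1.
rewrite -/(S n) in S1 aS tS; rewrite -/(S n.+1) in tS.
apply: (@le_trans _ _ (tail mu r (S n) - tail mu r (S n.+1))).
  apply: (@le_trans _ _ (2^-1 * a `^ (- S n))); last by lra.
  rewrite powRM//; last exact: ltW.
  rewrite ler_pM2r ?powR_gt0//.
  by rewrite powRN lef_pV2 ?posrE ?powR_gt0// le1r_powR// ler1n.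
have HS : H n.+1 `<=` H n by move=> t; apply: le_trans; exact: Smono.
rewrite -lee_fin EFinB leeBlDr// -!tailE// -fin_measure; last first.
  exact: measurableD.
rewrite -measureU//.
- apply: le_measure; rewrite ?inE.
  + exact: mH.
  + by apply: measurableU; [apply: measurableD; exact: mH|exact: mH].
  move=> t Ht; have [|] := pselect (H n.+1 t); by [right|left].
- by apply: measurableD; exact: mH.
- exact: mH.
- by apply/seteqP; split => // t [[_ ?]].
Qed.

End level_sets.

Section singular.
Context {d : measure_display} {T : measurableType d} {R : realType}.
Variable mu : {finite_measure set T -> \bar R}.

(** On A_n the exponent (p - q) / p is at most 1 / S_n, so
    mu(A_n) ^ ((p - q) / p) >= (a ^ (- S_n)) ^ (1 / S_n) = 1 / a. *)
Lemma superexp_tail_of_not_iso (p q : T -> R) : exponent p -> exponent q ->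
  {ae mu, forall t, (q t < p t)%R} ->
  (forall A : (set T)^nat,
      (forall n, measurable (A n)) -> (forall n, 0 < mu (A n)) ->
      trivIset setT A ->
      ~ iso_on (Lvar mu p) (Lvar mu q) id
          (closed_span (Lvar mu p) (fun n => normalized_indic mu p (A n)))) ->
  superexp_tail mu (fun t => p t / (p t - q t))%R.
Proof.
move=> pe qe qp noiso; apply: contrapT.
have [[mp p1] [mq q1]] := (pe, qe).
set r := fun _ => _.
have mr : measurable_fun setT r.
  by apply: measurable_funM => //; apply/measurable_funV/measurable_funB.
move=> /(disjoint_level_sets mr)[a [S [A [[a1 mA] tA S1 AS muA]]]].
have a0 : (0 < a)%R by lra.
have A0 n : 0 < mu (A n).
  rewrite fin_measure// lte_fin (lt_le_trans _ (muA n))// powR_gt0//.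
apply: (noiso A mA A0 tA).
apply: (@iso_on_span_indic _ _ _ mu p q pe qe qp A mA A0 tA a^-1%R).
  by rewrite invr_gt0 a0 invf_le1// ltW.
move=> n; apply: filterS qp => t qpt At.
have pt0 : (0 < p t)%R by have := p1 t; lra.
have g0 : (0 < (p t - q t) / p t)%R by rewrite divr_gt0// subr_gt0.
have Sn0 : (0 < S n)%R by have := S1 n; lra.
have r0 : (0 < r t)%R by rewrite /r -invf_div invr_gt0.
have gS : ((p t - q t) / p t <= (S n)^-1)%R.
  rewrite -invf_div lef_pV2 ?posrE//.
  by have := AS _ _ At; rewrite ger0_norm//; exact: ltW.
apply: (@le_trans _ _ ((a `^ (- S n)) `^ ((p t - q t) / p t))%R); last first.
  by rewrite ge0_ler_powR ?nnegrE ?powR_ge0// ?fine_ge0//; exact: ltW.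
rewrite -powRrM -[leLHS]powR_inv1; last exact: ltW.
apply: ler_powR; first exact: ltW.
by rewrite mulNr lerN2 mulrC -ler_pdivlMr// mul1r.
Qed.

End singular.

Theorem theorem4p1 (d : measure_display) (T : measurableType d) (R : realType)
    (mu : {finite_measure set T -> \bar R}) (p q : T -> R)
    (mu_atomless : atomless mu)
    (p_exp : exponent p) (q_exp : exponent q)
    (q_lt_p : {ae mu, forall t, (q t < p t)%R})
    (q_bounded : ess_sup mu (EFin \o q) < +oo) :
  let M : R := fine (mu setT) in
  let Lp := Lvar mu p in
  let Lq := Lvar mu q in
  [<->
    (* (1) *)
    forall a : R, (1 < a)%R ->
      \int[lebesgue_measure]_(x in `]0%R, M[%classic)
        (a `^ rearrangement mu (fun t => p t / (p t - q t))%R x)%:E < +oo;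
    (* (2) *)
    L_weakly_compact mu Lp Lq id;
    (* (3) *)
    M_weakly_compact mu Lp Lq id;
    (* (4) *)
    disjointly_strictly_singular mu Lp Lq id;
    (* (5) *)
    forall A : (set T)^nat,
      (forall n, measurable (A n)) -> (forall n, 0 < mu (A n)) ->
      trivIset setT A ->
      ~ iso_on Lp Lq id
          (closed_span Lp (fun n => normalized_indic mu p (A n)));
    (* (6) *)
    ((M - x) `^ rearrangement mu (fun t => (p t - q t) / p t) x)%R
      @[x --> within `[0%R, M[%classic (nbhs M)] --> (0 : R)%R
  ].
Proof.
move=> M Lp Lq; have [[mp p1] [mq q1]] := (p_exp, q_exp).
have mg : measurable_fun setT (fun t => (p t - q t) / p t)%R.
  by apply: measurable_funM; [exact: measurable_funB|exact: measurable_funV].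
have mr : measurable_fun setT (fun t => p t / (p t - q t))%R.
  by apply: measurable_funM => //; apply/measurable_funV/measurable_funB.
have rE : (fun t => p t / (p t - q t))%R = (fun t => ((p t - q t) / p t)^-1)%R.
  by apply/funext => t; rewrite invf_div.
split=> [/(rearrangement_superexp_tail mr)|].
  exact: L_weakly_compact_of_superexp_tail.
split; first exact: M_weakly_compact_of_L.
split; first exact: DSS_of_M_weakly_compact.
split=> [dss A mA A0 tA|]; first exact: not_iso_on_indic_of_DSS.
split=> [/(superexp_tail_of_not_iso p_exp q_exp q_lt_p)|].
  rewrite rE; apply: superexp_tail_limit => //.
  apply: filterS q_lt_p => t qpt.
  by rewrite gt_eqF// divr_gt0 ?subr_gt0// (lt_le_trans ltr01).
move=> /(limit_superexp_tail mg); rewrite -rE => rB a a1.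
exact: superexp_tail_rearrangement.
Qed.
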